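(* Let $K_1,K_2\subset\mathbb{R}^2$ be finite sets (of pixels), and let the underlying distance-function be $\delta(i,j,x,y)=(i-x)^2+(j-y)^2$. Let $\{\alpha(i,j):(i,j)\in K_1\}$, $\{\beta(x,y):(x,y)\in K_2\}$ be a feasible set of dual variables such that each pixel in $K_1$ and each pixel in $K_2$ has an admissible arc. Let $(i_0,j_0)\in K_1$. Let $(x_1,y_1)\in K_2$ be a pixel which is NE of $(i_0,j_0)$ and which is not an admissible pixel with respect to $(i_0,j_0)$. Let $(i_1,j_1)\in K_1$ be an admissible pixel with respect to $(x_1,y_1)$, and assume that $(i_1,j_1)$ is also NE of $(i_0,j_0)$. Then, if $(x_2,y_2)\in K_2$ is NE of $(x_1,y_1)$, the pixel $(x_2,y_2)$ is lower than $(x_1,y_1)$ (with respect to $(i_0,j_0)$).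
   Context: Dual variables are real numbers $\alpha(i,j)$, $(i,j)\in K_1$, and $\beta(x,y)$, $(x,y)\in K_2$. They are feasible if $\delta(i,j,x,y)-\alpha(i,j)-\beta(x,y)\ge 0$ for all $(i,j)\in K_1$, $(x,y)\in K_2$. A pair $\{(i,j),(x,y)\}$ with $(i,j)\in K_1$, $(x,y)\in K_2$ is an arc; it is admissible if $\alpha(i,j)+\beta(x,y)=\delta(i,j,x,y)$, and in that case $(x,y)$ is called an admissible pixel with respect to $(i,j)$ and vice versa. A pixel has an admissible arc if it belongs to at least one admissible arc. A pixel $(x',y')$ is NE (northeast) of a pixel $(x,y)$ if $x\le x'$ and $y\le y'$. A pixel $(x,y)\in K_2$ is low with respect to $(i,j)\in K_1$ if $\beta(x,y)<\delta(i,j,x,y)-\alpha(i,j)$. A pixel $(x',y')\in K_2$ is lower than $(x,y)\in K_2$ with respect to $(i,j)\in K_1$ if both are low with respect to $(i,j)$ and $\delta(i,j,x',y')-\alpha(i,j)-\beta(x',y')\ge\delta(i,j,x,y)-\alpha(i,j)-\beta(x,y)$. *)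

(* Defs.v *)
From HB Require Import structures.
From mathcomp Require Import all_boot all_order all_algebra.
From mathcomp Require Import finmap reals.

Set Implicit Arguments.
Unset Strict Implicit.
Unset Printing Implicit Defensive.

Import Order.TTheory GRing.Theory Num.Theory.
Local Open Scope ring_scope.

Definition sq_dist (R : realType) (p q : R * R) : R :=
  (p.1 - q.1) ^+ 2 + (p.2 - q.2) ^+ 2.

(* [NE p' p]: p' is northeast of p. *)
Definition NE (R : realType) (p' p : R * R) : Prop :=
  p.1 <= p'.1 /\ p.2 <= p'.2.

(* Below, K1 and K2 used as types denote the finite types of their elements,
   so the dual variables alpha and beta are indexed exactly by the pixels of
   K1 and K2; delta is an arbitrary distance-function. *)

Section Duals.
Variables (R : realType) (K1 K2 : {fset R * R}).
Variables (delta : R * R -> R * R -> R) (alpha : K1 -> R) (beta : K2 -> R).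

Definition feasible : Prop :=
  forall (p : K1) (q : K2), 0 <= delta (val p) (val q) - alpha p - beta q.

Definition admissible (p : K1) (q : K2) : Prop :=
  alpha p + beta q = delta (val p) (val q).

(* The arcs are those of the bipartite graph on the disjoint union of K1 and
   K2: a point lying in both sets gives two distinct nodes, each of which is
   required to have an admissible arc. *)
Definition has_admissible_arc1 (p : K1) : Prop := exists q : K2, admissible p q.
Definition has_admissible_arc2 (q : K2) : Prop := exists p : K1, admissible p q.

Definition low (p : K1) (q : K2) : Prop :=
  beta q < delta (val p) (val q) - alpha p.

(* [lower p q' q]: q' is lower than q with respect to p. *)
Definition lower (p : K1) (q' q : K2) : Prop :=
  [/\ low p q', low p q &
      delta (val p) (val q') - alpha p - beta q'
        >= delta (val p) (val q) - alpha p - beta q].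

End Duals.

(* Main.v *)
(* Write s(p, q) = delta(p, q) - alpha(p) - beta(q) >= 0 for the slack of an arc.
   For the squared distance,
     s(p0, q2) + s(p1, q1) - s(p0, q1) - s(p1, q2) = 2 <p1 - p0, q2 - q1>,
   which is nonnegative when p1 is NE of p0 and q2 is NE of q1.  Since
   s(p1, q1) = 0 and s(p1, q2) >= 0, this gives s(p0, q2) >= s(p0, q1) > 0. *)
Require Import Defs.
From HB Require Import structures.
From mathcomp Require Import all_boot all_order all_algebra.
From mathcomp Require Import finmap reals.
From mathcomp Require Import ring lra.

Set Implicit Arguments.
Unset Strict Implicit.
Unset Printing Implicit Defensive.

Import Order.TTheory GRing.Theory Num.Theory.
Local Open Scope ring_scope.

(** The dual variables cancel in the alternating sum of four slacks, so comparing slacks reduces to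
    this. *)
Lemma sq_dist_inverse_Monge (R : realType) (p p' q q' : R * R) :
  NE p' p -> NE q' q ->
  sq_dist p q + sq_dist p' q' <= sq_dist p q' + sq_dist p' q.
Proof.
case=> lep1 lep2 [leq1 leq2]; rewrite /sq_dist -subr_ge0.
(* The pairs [(a, b)], [(c, d)], [(e, f)], [(g, h)] stand for [p], [p'], [q], [q']. *)
have -> : forall a b c d e f g h : R,
    (a - g) ^+ 2 + (b - h) ^+ 2 + ((c - e) ^+ 2 + (d - f) ^+ 2)
    - ((a - e) ^+ 2 + (b - f) ^+ 2 + ((c - g) ^+ 2 + (d - h) ^+ 2))
    = 2 * ((c - a) * (g - e) + (d - b) * (h - f)) by move=> *; ring.
by rewrite mulr_ge0 // addr_ge0 // mulr_ge0 // subr_ge0.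
Qed.

Lemma feasible_low (R : realType) (K1 K2 : {fset R * R})
    (delta : R * R -> R * R -> R) (alpha : K1 -> R) (beta : K2 -> R)
    (p : K1) (q : K2) :
  feasible delta alpha beta -> ~ admissible delta alpha beta p q ->
  low delta alpha beta p q.
Proof.
move=> /(_ p q) slack_ge0 nadm; rewrite /low lt_neqAle -subr_ge0 slack_ge0 andbT.
by apply/eqP => eq_beta; apply: nadm; rewrite /admissible eq_beta addrC subrK.
Qed.

Theorem theorem3 (R : realType) (K1 K2 : {fset R * R})
    (alpha : K1 -> R) (beta : K2 -> R)
    (Hfeas : feasible (@sq_dist R) alpha beta)
    (Hadm1 : forall p : K1, has_admissible_arc1 (@sq_dist R) alpha beta p)
    (Hadm2 : forall q : K2, has_admissible_arc2 (@sq_dist R) alpha beta q)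
    (p0 : K1) (q1 : K2)
    (Hq1NE : NE (val q1) (val p0))
    (Hq1nadm : ~ admissible (@sq_dist R) alpha beta p0 q1)
    (p1 : K1)
    (Hp1adm : admissible (@sq_dist R) alpha beta p1 q1)
    (Hp1NE : NE (val p1) (val p0))
    (q2 : K2)
    (Hq2NE : NE (val q2) (val q1)) :
  lower (@sq_dist R) alpha beta p0 q2 q1.
Proof.
have low1 := feasible_low Hfeas Hq1nadm.
have monge := sq_dist_inverse_Monge Hp1NE Hq2NE.
have slack12 := Hfeas p1 q2.
move: (low1) Hp1adm; rewrite /low /admissible => lt1 eq1.
(* Linear in distances and duals: [monge], [slack12] and [eq1] compare the slacks at [p0]; [lt1]
   then makes that of [q2] positive. *)
by split=> //; rewrite /low; lra.
Qed.
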